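(* Let $S$ be a semilattice-ordered semigroup and let $\mathrm{cl}$ be an algebraic closure operator on $S$. Let $X=\{A\in\mathcal{P}(S)\mid A^{\mathrm{cl}}=A\}$ and $A\star B=(AB)^{\mathrm{cl}}$ for $A,B\in X$. If the map $\star:X\times X\to X$ is spectral, then the translations $L_A:X\to X$, $L_A(B)=A\star B$, and $R_B:X\to X$, $R_B(A)=A\star B$, are spectral for all $A,B\in X$.
   Context: A semilattice-ordered semigroup is a triple $(S,\cdot,\lor)$ with $S$ nonempty, $(S,\cdot)$ a semigroup, $(S,\lor)$ a semilattice (commutative, associative, idempotent), and $x(y\lor z)=xy\lor xz$, $(x\lor y)z=xz\lor yz$ for all $x,y,z\in S$. For $A,B\subseteq S$, $AB=\{ab\mid a\in A,b\in B\}$. $\mathcal{P}(S)$ is the power set of $S$ and $\mathcal{P}_{\mathrm{fin}}(A)$ is the set of finite subsets of $A$. A closure operator on $S$ is a map $\mathrm{cl}:\mathcal{P}(S)\to\mathcal{P}(S)$, written $A\mapsto A^{\mathrm{cl}}$, which is extensive, idempotent and order-preserving for inclusion. It is algebraic if $A^{\mathrm{cl}}=\bigcup\{F^{\mathrm{cl}}\mid F\in\mathcal{P}_{\mathrm{fin}}(A)\}$ for every $A\subseteq S$. The hull-kernel topology on $\mathcal{P}(S)$ has open subbasis $D(F)=\{A\in\mathcal{P}(S)\mid F\nsubseteq A\}$, $F\in\mathcal{P}_{\mathrm{fin}}(S)$. $X$ carries the subspace topology; since $\mathrm{cl}$ is algebraic, $X$ is a spectral space (quasi-compact, $T_0$,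 sober, with quasi-compact opens closed under finite intersections and forming a basis), and $X\times X$ with the product topology is a spectral space. A map between spectral spaces is spectral if the preimage of every quasi-compact open set is quasi-compact and open. *)

(* Defs.v *)
From HB Require Import structures.
From mathcomp Require Import all_boot all_order all_algebra.
From mathcomp Require Import all_classical all_reals all_analysis.

Set Implicit Arguments.
Unset Strict Implicit.
Unset Printing Implicit Defensive.

Local Open Scope classical_set_scope.

HB.mixin Record isSemilatticeOrdered d S
    & Semigroup S & Order.JoinSemilattice d S := {
  sos_inhabited : exists x : S, True;
  mulg_joinr (x y z : S) :
    (x * Order.join y z)%g = Order.join (x * y)%g (x * z)%g;
  mulg_joinl (x y z : S) :
    (Order.join x y * z)%g = Order.join (x * z)%g (y * z)%g
}.

#[short(type="sosemigroupType")]
HB.structure Definition SOSemigroup d :=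
  {S of isSemilatticeOrdered d S & Semigroup S & Order.JoinSemilattice d S}.

Definition set_mul (S : magmaType) (A B : set S) : set S :=
  [set (x * y)%g | x in A & y in B].

Definition fin_subsets (T : Type) (A : set T) : set (set T) :=
  [set F | finite_set F /\ F `<=` A].

Record closure_operator (T : Type) := ClosureOperator {
  closure_fun :> set T -> set T;
  closure_extensive : forall A, A `<=` closure_fun A;
  closure_idem : forall A, closure_fun (closure_fun A) = closure_fun A;
  closure_mono : forall A B, A `<=` B -> closure_fun A `<=` closure_fun B
}.

Definition algebraic (T : Type) (cl : closure_operator T) : Prop :=
  forall A : set T, cl A = \bigcup_(F in fin_subsets A) cl F.

(* An alias of [set T], so that the hull-kernel topology does not interfere
   with other topologies on the function type [T -> Prop]. *)
Definition hull_kernel (T : Type) : Type := set T.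

Definition hk_subbase (T : Type) (F : set T) : set (hull_kernel T) :=
  [set A : hull_kernel T | ~ (F `<=` A)].

HB.instance Definition _ (T : Type) := Choice.copy (hull_kernel T) (set T).
HB.instance Definition _ (T : Type) :=
  @isSubBaseTopological.Build (hull_kernel T) (set T)
    (fin_subsets [set: T]) (@hk_subbase T).

(* Used as a type, [closed_sets cl] carries the subspace topology, i.e. the
   library's topology on [set_type]. *)
Definition closed_sets (T : Type) (cl : closure_operator T) :
  set (hull_kernel T) := [set A : hull_kernel T | cl A = A].

Definition star (S : magmaType) (cl : closure_operator S)
    (A B : closed_sets cl) : closed_sets cl :=
  exist _ (cl (set_mul (\val A) (\val B)) : hull_kernel S)
    (mem_set (closure_idem cl (set_mul (\val A) (\val B)))).

(* [compact] is quasi-compactness: it involves no separation axiom. *)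
Definition spectral_map (X Y : topologicalType) (f : X -> Y) : Prop :=
  forall U : set Y, compact U -> open U ->
    compact (f @^-1` U) /\ open (f @^-1` U).

(* Main.v *)
Require Import Defs.
From HB Require Import structures.
From mathcomp Require Import all_boot all_order all_algebra.
From mathcomp Require Import all_classical all_reals all_analysis.

(** A translation is [star] with one coordinate frozen, so the preimage of a
    compact open set under it is a slice [W_x = {y | (x, y) in W}] of a compact
    open set [W] of the product.  The theorem therefore follows from a fact
    about arbitrary topological spaces: a slice of a compact open set is compact
    open.

    Openness is clear.  Compactness is not a closed-subset argument, because
    points need not be closed.  Instead, a proper filter on [W_x], transported
    to [{x} * W_x], clusters at some [(p, q)] of [W].  This forces [x] into
    every neighbourhood of [p] ([p] is in the closure of [{x}]), and [W] is open,
    so [(p, q)] can be traded for [(x, q)] without leaving [W]; then [q] is the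
    required cluster point in [W_x] ([compact_xslice]). *)

Local Open Scope classical_set_scope.

Lemma open_xslice (X Y : topologicalType) (W : set (X * Y)) (x : X) :
  open W -> open [set y | W (x, y)].
Proof.
move=> oW; apply: (open_comp (f := fun y => (x, y))) oW => y _.
by apply: cvg_pair; [exact: cvg_cst|exact: cvg_id].
Qed.

(** Openness of [W] replaces a separation axiom on [X]: it lets the first
    coordinate of a cluster point be moved to the point [x] that specialises
    to it. *)
Lemma compact_xslice (X Y : topologicalType) (W : set (X * Y)) (x : X) :
  open W -> compact W -> compact [set y | W (x, y)].
Proof.
move=> oW cW F FF FWx.
have [[p q] [Wpq clpq]] := cW ((fun y => (x, y)) @ F) _ FWx.
(* The transported filter contains the line over x, which every neighbourhood
   of (p, q) must therefore meet. *)
have px U : nbhs p U -> U x.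
  move=> pU.
  have Fx : ((fun y => (x, y)) @ F) [set z | z.1 = x].
    by apply: (@filterE _ F).
  have pqU : nbhs (p, q) [set z : X * Y | U z.1].
    exact: (@cvg_fst _ _ (nbhs p) (nbhs q) _ _ pU).
  by have [z [<- Uz]] := clpq _ _ Fx pqU.
have clq : cluster F q.
  move=> A B FA qB.
  have FA' : ((fun y => (x, y)) @ F) [set z | A z.2] by [].
  have pqB : nbhs (p, q) [set z : X * Y | B z.2].
    exact: (@cvg_snd _ _ (nbhs p) (nbhs q) _ _ qB).
  by have [z [Az Bz]] := clpq _ _ FA' pqB; exists z.2.
exists q; split=> //.
have [[U V] /= [pU qV] UVW] := open_nbhs_nbhs (conj oW Wpq).
by apply: (UVW (x, q)); split; [exact: px|exact: nbhs_singleton].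
Qed.

Lemma spectral_map_pairl (X Y Z : topologicalType) (f : X * Y -> Z) (x : X) :
  spectral_map f -> spectral_map (fun y => f (x, y)).
Proof.
move=> fS U cU oU; have [cW oW] := fS U cU oU.
by split; [exact: compact_xslice oW cW|exact: open_xslice oW].
Qed.

Lemma spectral_map_swap (X Y Z : topologicalType) (f : X * Y -> Z) :
  spectral_map f -> spectral_map (fun z : Y * X => f (z.2, z.1)).
Proof.
move=> fS U cU oU; have [cW oW] := fS U cU oU.
have cswap (T T' : topologicalType) :
    continuous (fun z : T * T' => (z.2, z.1)).
  by move=> [a b]; apply: cvg_pair; [exact: cvg_snd|exact: cvg_fst].
split; last first.
  apply: (open_comp (f := fun z : Y * X => (z.2, z.1))) oW => z _.
  exact: cswap.
(* Compactness passes to images, so the preimage is read as the image under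
   the inverse swap. *)
suff <- : (fun z : X * Y => (z.2, z.1)) @` (f @^-1` U) =
          (fun z : Y * X => f (z.2, z.1)) @^-1` U.
  by apply: continuous_compact cW; apply: continuous_subspaceT; exact: cswap.
apply/seteqP; split=> [_ [[a b] Uab <-]//|[b a] Uba].
by exists (a, b).
Qed.

Theorem corollary4p6 (d : Order.disp_t) (S : sosemigroupType d)
    (cl : closure_operator S) (cl_alg : algebraic cl) :
  spectral_map (fun AB : closed_sets cl * closed_sets cl => star AB.1 AB.2) ->
  forall A B : closed_sets cl,
    spectral_map (fun C : closed_sets cl => star A C) /\
    spectral_map (fun C : closed_sets cl => star C B).
Proof.
move=> star_spec A B; split.
  exact: spectral_map_pairl star_spec.
exact: spectral_map_pairl (spectral_map_swap _ _ _ _ star_spec).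
Qed.
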